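(* Let $U$ be an infinite set, $(\mathscr{S},\sqsubseteq)$ a partially ordered set, $(\mathfrak{R},\subseteq)$ a linearly ordered set, $\sigma$ a map from $\mathscr{S}$ to the set of infinite subsets of $U$ and $\rho:\mathscr{S}\to\mathfrak{R}$ a map such that for all $\underline X,\underline Y\in\mathscr S$: (i) $\underline X\sqsubseteq\underline Y$ implies $\sigma(\underline X)\subseteq\sigma(\underline Y)$; (ii) $\underline X\sqsubseteq\underline Y$ implies $\rho(\underline X)\subseteq\rho(\underline Y)$; (iii) for every $\mathfrak r\in\mathfrak R$ with $\mathfrak r\subseteq\rho(\underline X)$ there is $\underline R\in\mathscr S$ with $\underline R\sqsubseteq\underline X$ and $\rho(\underline R)=\mathfrak r$; (iv) $\mathscr S$ has a maximum $\underline U$ with $\sigma(\underline U)=U$. Let $(S,P)$ be a partition of $U$. Then there is $Q\in\{S,P\}$ such that $Q$ is large, and there exist a refinement $\underline V$ of $\underline U$ and a set $\mathscr V\subseteq\mathscr S$ with $\underline V\in\mathscr V$ such that for every $\underline X\in\mathscr V$: (1) $Q\cap\sigma(\underline X)$ is infinite; (2) every refinement of $\underline X$ belongs to $\mathscr V$; (3) $\gamma_{\mathscr V}(\underline X)$ holds.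
   Context: A refinement of $\underline Y$ is any $\underline X\sqsubseteq\underline Y$ with $\rho(\underline X)=\rho(\underline Y)$; an $\mathfrak r$-restriction of $\underline Y$ is any $\underline X\sqsubseteq\underline Y$ with $\rho(\underline X)=\mathfrak r$. For $\mathscr W\subseteq\mathscr S$ and $\underline X\in\mathscr S$, $\phi_{\mathscr W}(\underline X)$ is the statement: for every $\mathfrak r\in\mathfrak R$ with $\mathfrak r\subseteq\rho(\underline X)$ there is a refinement $\underline Y$ of $\underline X$ such that for every refinement $\underline Z$ of $\underline Y$ there is an $\mathfrak r$-restriction $\underline R$ of $\underline Z$ with $\underline R\in\mathscr W$. A set $Q\subseteq U$ is large if there is $\mathscr W\subseteq\mathscr S$ with $\underline U\in\mathscr W$ such that for every $\underline X\in\mathscr W$ the set $Q\cap\sigma(\underline X)$ is infinite and $\phi_{\mathscr W}(\underline X)$ holds. For $\mathscr Z\subseteq\mathscr S$, $\gamma_{\mathscr Z}(\underline X)$ is the statement: for every refinement $\underline Y$ of $\underline X$ and every $\mathfrak r\in\mathfrak R$ with $\mathfrak r\subseteq\rho(\underline X)$ there is an $\mathfrak r$-restriction $\underline R$ of $\underline Y$ with $\underline R\in\mathscr Z$. *)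

(* Defs.v *)
From mathcomp Require Import all_boot all_order.
From mathcomp Require Import boolp classical_sets functions cardinality.

Set Implicit Arguments.
Unset Strict Implicit.
Unset Printing Implicit Defensive.

Local Open Scope order_scope.
Local Open Scope classical_set_scope.

Definition restriction (dS dR : Order.disp_t) (E : porderType dS)
    (R : orderType dR) (rho : E -> R) (r : R) (X Y : E) : Prop :=
  X <= Y /\ rho X = r.

Definition refinement (dS dR : Order.disp_t) (E : porderType dS)
    (R : orderType dR) (rho : E -> R) (X Y : E) : Prop :=
  X <= Y /\ rho X = rho Y.

Definition phi (dS dR : Order.disp_t) (E : porderType dS)
    (R : orderType dR) (rho : E -> R) (W : set E) (X : E) : Prop :=
  forall r : R, r <= rho X ->
    exists Y : E, refinement rho Y X /\
      forall Z : E, refinement rho Z Y ->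
        exists T : E, restriction rho r T Z /\ W T.

Definition gamma (dS dR : Order.disp_t) (E : porderType dS)
    (R : orderType dR) (rho : E -> R) (V : set E) (X : E) : Prop :=
  forall (Y : E) (r : R), refinement rho Y X -> r <= rho X ->
    exists T : E, restriction rho r T Y /\ V T.

(* [Umax] is the maximum of [E]. *)
Definition large (dS dR : Order.disp_t) (U : Type) (E : porderType dS)
    (R : orderType dR) (sigma : E -> set U) (rho : E -> R) (Umax : E)
    (Q : set U) : Prop :=
  exists W : set E, W Umax /\
    forall X : E, W X -> infinite_set (Q `&` sigma X) /\ phi rho W X.

(* Main.v *)
(** Call [X] good for [Q] if it belongs to a family satisfying (1)-(3).  The
    family of all [X] having no refinement that is good for [P] satisfies (1)-(3)
    for [S]: if [S] meets [sigma X] in a finite set then the family of all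
    elements below [X] witnesses that [X] is good for [P], and if all
    [r]-restrictions of [Y] have refinements that are good for [P], then [Y] is
    itself good for [P].  So either [Umax] is good for [S] or some refinement of
    it is good for [P].  Largeness follows by adjoining [Umax] to the family. *)

Require Import Defs.
From mathcomp Require Import all_boot all_order.
From mathcomp Require Import boolp classical_sets functions cardinality.

Import Order.TTheory.

Local Open Scope order_scope.
Local Open Scope classical_set_scope.

Definition good_family {dS dR : Order.disp_t} {U : Type} {E : porderType dS}
    {R : orderType dR} (sigma : E -> set U) (rho : E -> R) (Q : set U)
    (VV : set E) : Prop :=
  forall X : E, VV X ->
    [/\ infinite_set (Q `&` sigma X),
        forall Y : E, refinement rho Y X -> VV Y
      & gamma rho VV X].

Definition good {dS dR : Order.disp_t} {U : Type} {E : porderType dS}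
    {R : orderType dR} (sigma : E -> set U) (rho : E -> R) (Q : set U) : set E :=
  [set X | exists2 VV : set E, VV X & good_family sigma rho Q VV].

Lemma refinement_refl {dS dR : Order.disp_t} {E : porderType dS}
    {R : orderType dR} (rho : E -> R) (X : E) : refinement rho X X.
Proof. by []. Qed.

Lemma refinement_trans {dS dR : Order.disp_t} {E : porderType dS}
    {R : orderType dR} (rho : E -> R) (X Y Z : E) :
  refinement rho X Y -> refinement rho Y Z -> refinement rho X Z.
Proof. by move=> [XY rXY] [YZ rYZ]; split; [exact: le_trans YZ|rewrite rXY]. Qed.

Lemma infinite_setI_mono {dS : Order.disp_t} {U : Type} {E : porderType dS}
    (sigma : E -> set U)
    (sigma_mono : forall X Y : E, X <= Y -> sigma X `<=` sigma Y)
    (Q : set U) (X Y : E) :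
  X <= Y -> infinite_set (Q `&` sigma X) -> infinite_set (Q `&` sigma Y).
Proof.
move=> XY Xinf Yfin; apply: Xinf; apply: sub_finite_set Yfin.
by apply: setIS; exact: sigma_mono.
Qed.

(** For a given element, (2) and (3) only ask that certain other elements lie in the family, so they
    survive enlarging it. Hence the union of all good families is again one, the largest. *)
Lemma good_family_good {dS dR : Order.disp_t} {U : Type} {E : porderType dS}
    {R : orderType dR} (sigma : E -> set U) (rho : E -> R) (Q : set U) :
  good_family sigma rho Q (good sigma rho Q).
Proof.
move=> X [VV VX VVg]; have [Xinf Xref Xgam] := VVg _ VX; split=> //.
  by move=> Y YX; exists VV => //; exact: Xref.
move=> Y r YX rX; have [T [TY VT]] := Xgam _ _ YX rX.
by exists T; split=> //; exists VV.
Qed.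

Lemma good_of_finite {dS dR : Order.disp_t} {U : Type} {E : porderType dS}
    {R : orderType dR} (sigma : E -> set U) (rho : E -> R)
    (sigma_infinite : forall X : E, infinite_set (sigma X))
    (sigma_mono : forall X Y : E, X <= Y -> sigma X `<=` sigma Y)
    (rho_restr : forall (X : E) (r : R), r <= rho X ->
       exists T : E, T <= X /\ rho T = r)
    (S P : set U) (SP_cover : S `|` P = [set: U]) (X : E) :
  finite_set (S `&` sigma X) -> good sigma rho P X.
Proof.
move=> Sfin; exists [set Y | Y <= X] => //= Y YX; split.
(* [sigma Y] is the union of its traces on [S] and [P]; the former is finite because it lies inside
   [sigma X]. *)
- move=> Pfin; apply: (sigma_infinite Y).
  rewrite -[sigma Y]setTI -SP_cover setIUl finite_setU; split=> //.
  by apply: sub_finite_set Sfin; apply: setIS; exact: sigma_mono.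
- by move=> Z [ZY _]; exact: le_trans YX.
- move=> Z r [ZY rZ] rY.
  have [T [TZ rT]] : exists T, T <= Z /\ rho T = r.
    by apply: rho_restr; rewrite rZ.
  by exists T; split=> //; exact: le_trans TZ (le_trans ZY YX).
Qed.

(* The elements below [Y] of rank at least [r] can be adjoined to the good ones;
   as ranks are linearly ordered, a rank prescribed by [gamma] is either at
   least [r] or is reached through a good refinement of an [r]-restriction. *)
Lemma good_of_restrictions {dS dR : Order.disp_t} {U : Type}
    {E : porderType dS} {R : orderType dR} (sigma : E -> set U) (rho : E -> R)
    (sigma_mono : forall X Y : E, X <= Y -> sigma X `<=` sigma Y)
    (rho_restr : forall (X : E) (r : R), r <= rho X ->
       exists T : E, T <= X /\ rho T = r)
    (Q : set U) (Y : E) (r : R) :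
  r <= rho Y ->
  (forall T : E, restriction rho r T Y ->
     exists2 T' : E, refinement rho T' T & good sigma rho Q T') ->
  good sigma rho Q Y.
Proof.
move=> rY restr_good.
pose upper := [set Z : E | Z <= Y /\ r <= rho Z].
have upper_good Z : upper Z ->
    exists T, [/\ T <= Z, rho T = r & good sigma rho Q T].
  (* Any [r]-restriction of [Z] is also one of [Y], so [restr_good] applies to it. *)
  move=> [ZY rZ]; have [T [TZ rT]] := rho_restr _ _ rZ.
  have [|T' [T'T rT'] T'good] := restr_good T.
    by split=> //; exact: le_trans ZY.
  by exists T'; split=> //; [exact: le_trans TZ|rewrite rT'].
exists (good sigma rho Q `|` upper); first by right.
move=> X [/good_family_good[Xinf Xref Xgam]|Xup].
  split=> // [Z ZX|Z s ZX sX]; first by left; exact: Xref.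
  by have [T [TZ Tgood]] := Xgam _ _ ZX sX; exists T; split=> //; left.
have upper_ref Z : refinement rho Z X -> upper Z.
  by move: Xup => [XY rX] [ZX rZ]; split; [exact: le_trans XY|rewrite rZ].
split.
(* The good [T] below [X] already meets [Q] in an infinite set. *)
- have [T [TX _ /good_family_good[Tinf _ _]]] := upper_good _ Xup.
  exact: infinite_setI_mono Tinf.
- by move=> Z /upper_ref; right.
- move=> Z s ZX sX; have Zup := upper_ref _ ZX.
  have sZ : s <= rho Z by rewrite ZX.2.
  have [rs|/ltW sr] := leP r s.
    have [T [TZ rT]] := rho_restr _ _ sZ.
    exists T; split=> //; right.
    by split; [exact: le_trans Zup.1|rewrite rT].
  have [T [TZ rT /good_family_good[_ _ Tgam]]] := upper_good _ Zup.
  have [|T' [[T'T rT'] T'good]] := Tgam T s (refinement_refl rho T).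
    by rewrite rT.
  by exists T'; split; [split=> //; exact: le_trans TZ|left].
Qed.

(** [Umax] itself may fail to be good, but [phi] lets one pass to a refinement first: [V] is chosen,
    and [gamma] at [V] supplies the restrictions. *)
Lemma large_of_good {dS dR : Order.disp_t} {U : Type} {E : porderType dS}
    {R : orderType dR} (sigma : E -> set U) (rho : E -> R)
    (sigma_mono : forall X Y : E, X <= Y -> sigma X `<=` sigma Y)
    (Q : set U) (Umax V : E) :
  refinement rho V Umax -> good sigma rho Q V -> large sigma rho Umax Q.
Proof.
move=> VU Vgood; exists (good sigma rho Q `|` [set Umax]); split; first by right.
(* Applied with [Y] equal to [X] when [X] is good, and to [V] when [X] is [Umax]. *)
have phi_of_good X Y : refinement rho Y X -> good sigma rho Q Y ->
    phi rho (good sigma rho Q `|` [set Umax]) X.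
  move=> YX /good_family_good[_ _ Ygam] r rX; exists Y; split=> // Z ZY.
  have [|T [TZ Tgood]] := Ygam Z r ZY; first by rewrite YX.2.
  by exists T; split=> //; left.
move=> X [Xgood|->]; split.
- by have [] := good_family_good sigma rho Q X Xgood.
- exact: phi_of_good (refinement_refl rho X) Xgood.
- have [Vinf _ _] := good_family_good sigma rho Q V Vgood.
  exact: infinite_setI_mono VU.1 Vinf.
- exact: phi_of_good VU Vgood.
Qed.

Theorem theorem7p2 (dS dR : Order.disp_t) (U : Type) (E : porderType dS)
    (R : orderType dR) (sigma : E -> set U) (rho : E -> R) (Umax : E)
    (U_infinite : infinite_set [set: U])
    (sigma_infinite : forall X : E, infinite_set (sigma X))
    (sigma_mono : forall X Y : E, X <= Y -> sigma X `<=` sigma Y)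
    (rho_mono : forall X Y : E, X <= Y -> rho X <= rho Y)
    (rho_restr : forall (X : E) (r : R), r <= rho X ->
       exists T : E, T <= X /\ rho T = r)
    (Umax_max : forall X : E, X <= Umax)
    (sigma_Umax : sigma Umax = [set: U])
    (S P : set U)
    (SP_cover : S `|` P = [set: U])
    (SP_disjoint : S `&` P = set0) :
  exists Q : set U, (Q = S \/ Q = P) /\
    large sigma rho Umax Q /\
    exists (V : E) (VV : set E),
      refinement rho V Umax /\ VV V /\
      forall X : E, VV X ->
        [/\ infinite_set (Q `&` sigma X),
            forall Y : E, refinement rho Y X -> VV Y
          & gamma rho VV X].
Proof.
suff [Q [QSP [V VU Vgood]]] : exists Q, (Q = S \/ Q = P) /\
    exists2 V, refinement rho V Umax & good sigma rho Q V.
  exists Q; split=> //; split; first exact: large_of_good VU Vgood.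
  exists V, (good sigma rho Q); split=> //; split=> //.
  exact: good_family_good.
have [?|noP] :=
    pselect (exists2 V, refinement rho V Umax & good sigma rho P V).
  by exists P; split=> //; right.
exists S; split; first by left.
exists Umax; first exact: refinement_refl.
(* [noP] is exactly the membership of [Umax] in this family. *)
exists [set X | ~ exists2 Y, refinement rho Y X & good sigma rho P Y] => //.
move=> X /= noX; split.
- move=> Sfin; apply: noX; exists X; first exact: refinement_refl.
  exact: (good_of_finite _ _ sigma_infinite sigma_mono rho_restr S).
- move=> Y YX [Z ZY Zgood]; apply: noX; exists Z => //.
  exact: refinement_trans YX.
(* If every [r]-restriction of [Y] left the family, each would have a refinement good for [P],
   making [Y] a good refinement of [X]. *)
- move=> Y r YX rX; apply: contrapT => noT; apply: noX; exists Y => //.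
  apply: (good_of_restrictions _ _ sigma_mono rho_restr P Y r).
    by rewrite YX.2.
  by move=> T TY; apply: contrapT => noT'; apply: noT; exists T.
Qed.
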